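(* For each integer $n\ge 0$, let $a_n$ denote the number of tilings of a $6\times 4n$ board by $L$-tetrominoes (rotations allowed, reflections not allowed). Then the generating function is $\sum_{n\ge 0}a_nt^n=-A(t)/B(t)$, where \[ A(t)=(t -1)^{2} (t^{9}-17 t^{8}+114 t^{7}-386 t^{6}+714 t^{5}-732 t^{4}+412 t^{3}-123 t^{2}+18 t -1), \] and \begin{align*} B(t)&=t^{12}-24 t^{11}+239 t^{10}-1280 t^{9}+4051 t^{8}-7944 t^{7}+9918 t^{6}-8001 t^{5}\\ &\qquad +4138 t^{4}-1330 t^{3}+251 t^{2}-25 t +1. \end{align*} The first terms of the sequence $(a_n)_{n\ge 0}$ are $1, 5, 34, 249, 1882, 14492, 113029, 889719, 7050677, \ldots$
   Context: A $k\times n$ board is the rectangle of unit cells $\{(x,y)\in\mathbb{Z}^2: 0\le x<n,\ 0\le y<k\}$, where each cell is named by its bottom left corner. The $L$-tetromino tiles are the translates of the four sets (the rotations of the $L$-tetromino) \[\{(0,0),(0,1),(0,2),(1,0)\},\ \{(0,0),(0,1),(1,1),(2,1)\},\ \{(0,0),(1,0),(2,0),(2,1)\},\ \{(0,2),(1,0),(1,1),(1,2)\}.\] Reflections of these shapes are not allowed. A tiling of a board is a partition of its set of cells into such tiles (each tile may be used any number of times); two tilings are the same only if they are equal as partitions of the board (no identification under symmetries). The empty board ($n=0$) has exactly one tiling. Generating functions are formal power series in $t$ with rational coefficients. *)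

(* Defs.v *)
(* BinNat provides the number notation for [N]; it is loaded before MathComp so
   that MathComp's delimiters (%N for nat, %num for binary N) are the ones in
   force. *)
From Stdlib Require Import BinNat.
From mathcomp Require Import all_boot all_order all_algebra.

Set Implicit Arguments.
Unset Strict Implicit.
Unset Printing Implicit Defensive.

Import Order.TTheory GRing.Theory Num.Theory.
Local Open Scope ring_scope.

(* The k x n board has k rows and n columns: x < n comes first. *)
Definition cell (k n : nat) : finType := ('I_n * 'I_k)%type.

Definition coord (k n : nat) (c : cell k n) : int * int :=
  ((val c.1)%:Z, (val c.2)%:Z).

Definition L_shapes : seq (seq (int * int)) :=
  [:: [:: (0, 0); (0, 1); (0, 2); (1, 0)];
      [:: (0, 0); (0, 1); (1, 1); (2, 1)];
      [:: (0, 0); (1, 0); (2, 0); (2, 1)];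
      [:: (0, 2); (1, 0); (1, 1); (1, 2)] ].

Definition translate (v : int * int) (s : seq (int * int)) : seq (int * int) :=
  [seq v + z | z <- s].

(* Each shape has least abscissa 0 and least ordinate 0, so a translate lying
   inside the board has a translation vector that is itself a cell of the
   board; [is_tileP] below states the property with arbitrary vectors of Z^2. *)
Definition is_tile (k n : nat) (S : {set cell k n}) : bool :=
  [exists v : cell k n,
     has (fun s => perm_eq [seq coord c | c in S] (translate (coord v) s))
         L_shapes].

Definition is_tiling (k n : nat) (P : {set {set cell k n}}) : bool :=
  partition P [set: cell k n] && [forall S in P, is_tile S].

Definition num_tilings (k n : nat) : nat :=
  #|[set P : {set {set cell k n}} | is_tiling P]|.

(* A formal power series over rat is its sequence of coefficients; equality of
   series is pointwise equality [=1]. *)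
Definition fps : Type := nat -> rat.

Definition gen_fun (a : nat -> nat) : fps := fun n => (a n)%:R.

Definition fps_of_poly (p : {poly rat}) : fps := fun n => p`_n.

Definition fps_one : fps := fun n => (n == 0%N)%:R.

Definition fps_mul (f g : fps) : fps :=
  fun n => \sum_(i < n.+1) f i * g (n - i)%N.

(* First m coefficients of the inverse of g, computed by the recurrence
   h_n = g_0^-1 * ([n = 0] - \sum_(i < n) h_i * g_(n - i)). *)
Fixpoint fps_inv_coefs (g : fps) (m : nat) : seq rat :=
  if m is n.+1 then
    let h := fps_inv_coefs g n in
    rcons h ((g 0%N)^-1 * (fps_one n - \sum_(i < n) h`_i * g (n - i)%N))
  else [::].

Definition fps_inv (g : fps) : fps := fun n => (fps_inv_coefs g n.+1)`_n.

Definition fps_div (f g : fps) : fps := fps_mul f (fps_inv g).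

Definition polyA : {poly rat} :=
  ('X - 1) ^+ 2 *
  ('X^9 - 17 *: 'X^8 + 114 *: 'X^7 - 386 *: 'X^6 + 714 *: 'X^5 - 732 *: 'X^4
   + 412 *: 'X^3 - 123 *: 'X^2 + 18 *: 'X - 1).

Definition polyB : {poly rat} :=
  'X^12 - 24 *: 'X^11 + 239 *: 'X^10 - 1280 *: 'X^9 + 4051 *: 'X^8 - 7944 *: 'X^7
  + 9918 *: 'X^6 - 8001 *: 'X^5 + 4138 *: 'X^4 - 1330 *: 'X^3 + 251 *: 'X^2
  - 25 *: 'X + 1.

Lemma coord_inj (k n : nat) : injective (@coord k n).
Proof. by move=> [x y] [x' y'] [/val_inj -> /val_inj ->]. Qed.

Lemma is_tileP (k n : nat) (S : {set cell k n}) :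
  reflect (exists v : int * int, exists2 s, s \in L_shapes &
             [seq coord c | c in S] =i translate v s)
          (is_tile S).
Proof.
apply: (iffP existsP) => [[v /hasP[s sL /perm_mem eqS]]|[v [s sL eqS]]].
  by exists (coord v), s.
have mem_board z : z \in s -> exists c : cell k n, coord c = v + z.
  move=> zs; have := map_f (fun z => v + z) zs.
  by rewrite -/(translate v s) -eqS => /imageP[c _ ->]; exists c.
have [[zx zy] [zxs zx0 zys zy0]] : exists z : (int * int) * (int * int),
    [/\ z.1 \in s, z.1.1 = 0, z.2 \in s & z.2.2 = 0].
  move: sL; rewrite !inE => /or4P[]/eqP->;
    [ exists ((0, 0), (0, 0)) | exists ((0, 0), (0, 0))
    | exists ((0, 0), (0, 0)) | exists ((0, 2), (1, 0)) ]; by split.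
have [cx ecx] := mem_board _ zxs; have [cy ecy] := mem_board _ zys.
have ev : coord (cx.1, cy.2) = v.
  rewrite /coord /=.
  move/(congr1 fst): ecx => /= ->; move/(congr1 snd): ecy => /= ->.
  by rewrite zx0 zy0 !addr0; case: (v).
exists (cx.1, cy.2); apply/hasP; exists s => //; rewrite ev.
apply: uniq_perm => //.
- by rewrite map_inj_uniq ?enum_uniq //; apply: coord_inj.
- rewrite map_inj_uniq; last exact: addrI.
  by move: sL; rewrite !inE => /or4P[]/eqP->.
Qed.

Lemma size_fps_inv_coefs (g : fps) (m : nat) : size (fps_inv_coefs g m) = m.
Proof. by elim: m => //= m IH; rewrite size_rcons IH. Qed.

Lemma nth_fps_inv_coefs (g : fps) (m n : nat) :
  (n < m)%N -> (fps_inv_coefs g m)`_n = fps_inv g n.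
Proof.
elim: m => // m IH; rewrite ltnS leq_eqVlt => /predU1P[-> // | ltnm].
by rewrite /= nth_rcons size_fps_inv_coefs ltnm IH.
Qed.

Lemma fps_invE (g : fps) (n : nat) :
  fps_inv g n =
  (g 0%N)^-1 * (fps_one n - \sum_(i < n) fps_inv g i * g (n - i)%N).
Proof.
rewrite {1}/fps_inv /= nth_rcons size_fps_inv_coefs ltnn eqxx.
by under eq_bigr => i _ do rewrite nth_fps_inv_coefs //.
Qed.

Lemma fps_mulVf (g : fps) : g 0%N != 0 -> fps_mul (fps_inv g) g =1 fps_one.
Proof.
move=> g0 n; rewrite /fps_mul big_ord_recr /= subnn [fps_inv g n]fps_invE.
by rewrite mulrAC mulVf // mul1r addrC subrK.
Qed.

Lemma polyB_coef0 : fps_of_poly polyB 0%N = 1.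
Proof.
have coefZXS (c : rat) n : (c *: 'X^(n.+1))`_0 = 0 by rewrite coefZ coefXn mulr0.
have coefZX1 (c : rat) : (c *: 'X)`_0 = 0 by rewrite coefZ coefX mulr0.
rewrite /fps_of_poly /polyB.
rewrite !(coefD, coefN).
rewrite !coefZXS coefZX1.
rewrite coefXn coef1.
by rewrite oppr0 !addr0.
Qed.

(* Main.v *)
(* Fill the 6-row board cell by cell in column-major order. The uncovered region
   is then determined by the number of remaining cells and by the covered cells
   among the next few, so the tilings are counted by a transfer matrix. Only 26
   states occur every four columns, and the vectors e M^n (e the initial state, M
   the transfer over four columns) satisfy the linear recurrence of order 13 with
   characteristic polynomial x^13 B(1/x). Hence the coefficients of a(t) B(t)
   vanish from index 13 on; the first 13 are computed and are those of -A. *)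
Require Import Defs.
From Stdlib Require Import BinNat ZArith.
From mathcomp Require Import all_boot all_order all_algebra.
From mathcomp Require Import zify ring ssrZ.

Import GRing.Theory.

(** * Tilings of a finite set, split along the block of one point *)

Section Tilings.

Variables (T : finType) (tile : pred {set T}).

Definition tilings (D : {set T}) : {set {set {set T}}} :=
  [set P | partition P D && [forall S in P, tile S]].

Lemma card_tilings_set0 : #|tilings set0| = 1.
Proof.
rewrite (_ : tilings set0 = [set set0]) ?cards1 //.
apply/setP => P; rewrite !inE partition_set0.
case: eqP => // ->; apply/forall_inP => S; by rewrite inE.
Qed.

(** Removing the block [S] of [c] is a bijection from the tilings of [D] that use [S] onto the
    tilings of [D :\: S]. *)
Lemma card_tilings_rec (D : {set T}) (c : T) : c \in D ->
  #|tilings D| = \sum_(S | [&& tile S, c \in S & S \subset D]) #|tilings (D :\: S)|.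
Proof.
move=> cD; rewrite -sum1_card.
rewrite (partition_big (fun P => pblock P c)
  (fun S => [&& tile S, c \in S & S \subset D])) /=; last first.
  move=> P; rewrite inE => /andP[partP /forall_inP tP].
  have cP : c \in cover P by rewrite (cover_partition partP).
  by rewrite tP ?pblock_mem // mem_pblock cP (partitionS partP) // pblock_mem.
apply: eq_bigr => S /and3P[tS cS SD]; rewrite -[RHS]sum1_card.
have notin Q : Q \in tilings (D :\: S) -> S \notin Q.
  rewrite inE => /andP[partQ _]; apply/negP => SQ.
  by have /subsetP/(_ c cS) := partitionS partQ SQ; rewrite inE cS.
rewrite (reindex_onto (fun Q => S |: Q) (fun P => P :\ S)) /=.
  apply: eq_bigl => Q; apply/andP/idP => [[/andP[]]|QD].
    rewrite !inE => /andP[partP /forall_inP tP] _ /eqP eQ.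
    rewrite -{1}eQ (partitionD1 partP) ?setU11 //=.
    by apply/forall_inP => S' S'Q; apply: tP; rewrite setU1r.
  rewrite setU1K ?notin // eqxx; split => //.
  move: QD; rewrite !inE => /andP[partQ /forall_inP tQ].
  have partP : partition (S |: Q) D.
    have -> : D = S :|: (D :\: S) by rewrite -[in LHS](setID D S) (setIidPr SD).
    rewrite partitionU1 //; last by rewrite disjoint_sym disjoints_subset subsetDr.
    by apply/set0Pn; exists c.
  rewrite partP /=; apply/andP; split.
    by apply/forall_inP => S' /setU1P[->//|]; apply: tQ.
  by rewrite (def_pblock (partition_trivIset partP) (setU11 _ _) cS).
move=> P /andP[]; rewrite inE => /andP[partP _] /eqP <-.
by rewrite setD1K // pblock_mem // (cover_partition partP).
Qed.

End Tilings.

(* In [(o, (l, h))], [o] lists the cells of the tile in the column-major numbering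
   of the board (6 per column), relative to the first one, and [l], [h] bound the
   rows in which that first cell may lie. *)
Definition shape : Type := seq nat * (nat * nat).

Definition shapes : seq shape :=
  [:: ([:: 0; 1; 2; 6], (0, 3)); ([:: 0; 1; 7; 13], (0, 4));
      ([:: 0; 6; 12; 13], (0, 4)); ([:: 0; 4; 5; 6], (2, 5))].

Definition fits (y : nat) (s : shape) : bool := s.2.1 <= y <= s.2.2.

(* The state [w] lists the covered cells, as offsets from the current cell, all
   earlier cells being covered. *)
Definition shift (w : seq nat) : seq nat := [seq i.-1 | i <- w & 0 < i].

(** Sorting makes the list of a state canonical, so that [insert] can merge equal states. *)
Definition successors (y : nat) (w : seq nat) : seq (seq nat) :=
  if 0 \in w then [:: shift w] else
  [seq shift (sort leq (w ++ s.1)) | s <- shapes & fits y s && ~~ has [in w] s.1].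

(* [r] cells remain. Tiles may stick out of the board here: such a placement leaves
   a nonempty state when no cell remains, hence contributes 0. *)
Fixpoint completions (r : nat) (w : seq nat) : nat :=
  if r is r'.+1 then
    \sum_(w' <- successors (5 - r' %% 6) w) completions r' w'
  else (w == [::]).

Lemma mem_shift (w : seq nat) (i : nat) : (i \in shift w) = (i.+1 \in w).
Proof.
apply/mapP/idP => [[j]|iw]; last by exists i.+1; rewrite ?mem_filter.
by rewrite mem_filter => /andP[j0 jw] ->; rewrite prednK.
Qed.

(** [r] and the offset decrease together, so an offset beyond the end is still present when no cell
    remains. *)
Lemma completions_overflow (r : nat) (w : seq nat) :
  ~~ all (gtn r) w -> completions r w = 0.
Proof.
elim: r w => [|r IH] w; first by case: w.
case/allPn => i iw; rewrite -leqNgt => ri.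
have over w' : i \in w' -> completions r (shift w') = 0.
  move=> iw'; apply: IH; apply/allPn; exists i.-1; rewrite ?mem_shift ?prednK //=; lia.
rewrite /= /successors; case: ifP => _; first by rewrite big_seq1 over.
by rewrite big_map big1 // => s _; rewrite over // mem_sort mem_cat iw.
Qed.

(** * Tilings of a board region as completions of a state *)

Section Board.

Variable n : nat.
Implicit Types (c : cell 6 n) (S : {set cell 6 n}) (s : shape).

Definition idx c : nat := 6 * c.1 + c.2.

Lemma idx_lt c : idx c < 6 * n.
Proof. by case: c => [x y]; rewrite /idx /=; have := ltn_ord x; have := ltn_ord y; lia. Qed.

Lemma idx_surj p : p < 6 * n -> exists c, idx c = p.
Proof.
move=> pn; have xn : p %/ 6 < n by lia.
have y6 : p %% 6 < 6 by lia.
by exists (Ordinal xn, Ordinal y6); rewrite /idx /=; lia.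
Qed.

Definition region p (w : seq nat) : {set cell 6 n} :=
  [set c | (p <= idx c) && (idx c - p \notin w)].

Definition placed p s : {set cell 6 n} :=
  [set c | (p <= idx c) && (idx c - p \in s.1)].

(** [fits] keeps offsets from wrapping into a neighbouring column; the bound on indices handles the
    right edge. *)
Definition placeable p s : bool := fits (p %% 6) s && all (fun o => p + o < 6 * n) s.1.

Lemma head_shapes s : s \in shapes -> 0 \in s.1.
Proof. by move: s; apply/allP. Qed.

Definition on_board (z : int * int) : bool :=
  [&& (0 <= z.1)%R, (z.1 < n%:Z)%R, (0 <= z.2)%R & (z.2 < 6)%R].

Lemma on_boardP (z : int * int) : reflect (exists c, Defs.coord c = z) (on_board z).
Proof.
apply: (iffP and4P) => [[z10 z1n z20 z26]|[[x y] <-]] /=; last first.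
  by have := ltn_ord x; have := ltn_ord y; split; lia.
have xn : `|z.1|%N < n by lia.
have y6 : `|z.2|%N < 6 by lia.
exists (Ordinal xn, Ordinal y6).
by rewrite [RHS]surjective_pairing; congr pair => /=; lia.
Qed.

Lemma mem_translate v u (z : int * int) : (z \in translate v u) = ((z - v)%R \in u).
Proof. by rewrite -[RHS](mem_map (@addrI _ v)) addrC subrK. Qed.

Lemma is_tileE S : is_tile S <-> exists v : int * int, exists2 u, u \in L_shapes &
  all on_board (translate v u) /\ S = [set c | Defs.coord c \in translate v u].
Proof.
split=> [/is_tileP[v [u uL eS]]|[v [u uL [/allP onb ->]]]].
  exists v, u => //; split.
    by apply/allP => z; rewrite -eS => /imageP[c _ ->]; apply/on_boardP; exists c.
  apply/setP => c; rewrite inE -eS; apply/idP/imageP => [cS|[c' c'S]].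
    by exists c.
  by move/(@coord_inj _ _) ->.
apply/is_tileP; exists v, u => // z; apply/imageP/idP => [[c]|zu].
  by rewrite inE => cu ->.
by have /on_boardP[c ec] := onb z zu; exists c; rewrite // inE ec.
Qed.

(* The cell of index [p] is the first one of the translate in the column-major
   order; its row inside the bounding box is the least row allowed by [fits]. *)
Definition corner p s : int * int := ((p %/ 6)%:Z, (p %% 6)%:Z - (s.2.1)%:Z)%R.

Lemma translate_corner p u s : (u, s) \in zip L_shapes shapes ->
  all on_board (translate (corner p s) u) = placeable p s
  /\ (placeable p s -> [set c | Defs.coord c \in translate (corner p s) u] = placed p s).
Proof.
have addE (x y x' y' : int) : ((x, y) + (x', y') = (x + x', y + y'))%R by [].
have oppE (x y : int) : (- (x, y) = (- x, - y))%R by [].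
move=> us; split.
  move: us; rewrite !inE => /or4P[]/eqP[-> ->];
  rewrite /placeable /corner /fits /translate /= !addE /on_board /=; lia.
case/andP=> pfits _; apply/setP => -[x y]; rewrite !inE mem_translate.
rewrite /Defs.coord /corner /idx oppE addE /=.
have := ltn_ord y; move: (nat_of_ord x) (nat_of_ord y) => {}x {}y y6.
move: us pfits; rewrite !inE => /or4P[]/eqP[-> ->];
rewrite /fits /= !inE !xpair_eqE; lia.
Qed.

Lemma is_tile_placed S :
  is_tile S <-> exists p s, [/\ s \in shapes, placeable p s & S = placed p s].
Proof.
rewrite is_tileE; split=> [[v [u uL [onb ->]]]|[p [s [ss ps ->]]]]; last first.
  have [u uL us] : exists2 u, u \in L_shapes & (u, s) \in zip L_shapes shapes.
    by apply/hasP; move: s ss {ps}; apply/allP.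
  have [eb es] := translate_corner p _ _ us.
  by exists (corner p s), u => //; rewrite eb es.
have [s ss us] : exists2 s, s \in shapes & (u, s) \in zip L_shapes shapes.
  by apply/hasP; move: u uL {onb}; apply/allP.
have [p ev] : exists p, v = corner p s.
  (* The first cell of the tile lies in column [v.1] and row [v.2 + s.2.1]. *)
  exists `|(6 * v.1 + v.2 + (s.2.1)%:Z)%R|%N.
  case: v onb => vx vy; move: us; rewrite !inE => /or4P[]/eqP[-> ->];
  rewrite /corner /translate /= /on_board /= => *; congr pair; lia.
have [eb es] := translate_corner p _ _ us.
by exists p, s; rewrite ev eb in onb *; rewrite es.
Qed.

(** On the board every offset is realised by a cell, and no shape has its offsets contained in those
    of another. *)
Lemma placed_inj p : {in [pred s | (s \in shapes) && placeable p s] &,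
  injective (placed p)}.
Proof.
have sub s t : placeable p s -> placed p s = placed p t -> {subset s.1 <= t.1}.
  case/andP=> _ /allP sn est o os.
  have [c ec] := idx_surj _ (sn o os).
  have : c \in placed p s by rewrite inE ec leq_addr addKn.
  by rewrite est inE ec leq_addr addKn.
have sep : {in shapes &, forall s t, all [in t.1] s.1 -> s = t}.
  move=> s t; rewrite !inE => /or4P[]/eqP-> /or4P[]/eqP-> //.
move=> s t /andP[ss ps] /andP[ts pt] est; apply: sep => //.
by apply/allP; apply: sub.
Qed.

(** Induction on [r]: when cell [p] is uncovered it is the first cell of the region, hence the first
    cell of the tile covering it. *)
Lemma card_tilings_region r w p : p + r = 6 * n -> all (gtn r) w ->
  #|tilings _ (@is_tile 6 n) (region p w)| = completions r w.
Proof.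
elim: r p w => [|r IH] p w epr wr.
  have -> : region p w = set0.
    by apply/setP => c; rewrite !inE; have := idx_lt c; lia.
  by rewrite card_tilings_set0; case: w wr.
have {}IH w' : all (gtn r.+1) w' ->
    #|tilings _ (@is_tile 6 n) (region p.+1 (shift w'))| = completions r (shift w').
  move=> w'r; apply: IH; first lia.
  by apply/allP => i; rewrite mem_shift => /(allP w'r) /=.
have [c0 ec0] : exists c, idx c = p by apply: idx_surj; lia.
rewrite /= /successors; case: ifP => w0.
  rewrite big_seq1 -IH //; congr #|tilings _ _ _|; apply/setP => c.
  rewrite !inE mem_shift ltn_neqAle; case: (ltngtP p (idx c)) => [lt|//|<-].
    by rewrite subnSK.
  by rewrite subnn w0.
rewrite (@card_tilings_rec _ _ _ c0); last by rewrite inE ec0 leqnn subnn w0.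
(* Both sides are the row of the current cell, because [p + r.+1 = 6 * n]. *)
have ey : 5 - r %% 6 = p %% 6 by lia.
rewrite big_map ey big_filter.
transitivity (\sum_(s <- shapes | placeable p s && ~~ has [in w] s.1)
    #|tilings _ (@is_tile 6 n) (region p w :\: placed p s)|).
  rewrite -[RHS]big_filter -[RHS](big_map _ xpredT
    (fun S => #|tilings _ (@is_tile 6 n) (region p w :\: S)|)).
  rewrite [RHS]big_uniq; last first.
    rewrite map_inj_in_uniq ?filter_uniq // => s t.
    rewrite !mem_filter => /andP[/andP[ps _] ss] /andP[/andP[pt _] ts].
    by apply: placed_inj; rewrite inE ?ss ?ts.
  apply: eq_bigl => S; apply/and3P/mapP => [[/is_tile_placed[q [s [ss ps ->]]] c0S SD]|].
    (* The tile contains cell [p], so [q <= p]; its first cell lies in the region, so [p <= q]. *)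
    have qp : q = p.
      have [c ec] : exists c, idx c = q.
        by apply: idx_surj; have := idx_lt c0; move: c0S; rewrite inE; lia.
      have : c \in placed q s by rewrite inE ec leqnn subnn head_shapes.
      move/(subsetP SD); rewrite inE ec => /andP[pq _].
      by move: c0S; rewrite inE ec0 => /andP[qp _]; apply/eqP; rewrite eqn_leq qp.
    subst q; exists s => //; rewrite mem_filter ps ss /= andbT.
    apply/hasPn => o os; have [c ec] := idx_surj _ (allP (andP ps).2 _ os).
    have : c \in placed p s by rewrite inE ec leq_addr addKn.
    by move/(subsetP SD); rewrite inE ec leq_addr addKn.
  case=> s; rewrite mem_filter => /andP[/andP[ps dis] ss] ->; split.
  - by apply/is_tile_placed; exists p, s.
  - by rewrite inE ec0 leqnn subnn head_shapes.
  - apply/subsetP => c; rewrite !inE => /andP[-> cs]; exact: (hasPn dis).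
rewrite big_mkcond [RHS]big_mkcond; apply: eq_big_seq => s ss.
rewrite /placeable; case: (fits _ s) => //=; case: hasP => /= [_|dis].
  by rewrite andbF.
rewrite andbT; set w' := sort leq (w ++ s.1).
have ew' i : (i \in w') = (i \in w) || (i \in s.1) by rewrite mem_sort mem_cat.
(* A tile overrunning the last column is absent from the left side and contributes 0 to the right
   side. *)
have [alls|overs] := boolP (all _ _); last first.
  case/allPn: overs => o os; rewrite -leqNgt => opn.
  rewrite completions_overflow //; apply/allPn; exists o.-1; last by rewrite /=; lia.
  by rewrite mem_shift prednK ?ew' ?os ?orbT //; lia.
rewrite -IH; last first.
  apply/allP => i; rewrite ew' => /orP[/(allP wr)//|/(allP alls)] /=; lia.
congr #|tilings _ _ _|; apply/setP => c.
rewrite !inE mem_shift ltn_neqAle; case: (ltngtP p (idx c)) => [lt|//|<-] /=.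
  by rewrite subnSK // ew' negb_or andbC.
by rewrite subnn head_shapes.
Qed.

Lemma num_tilings6 : num_tilings 6 n = completions (6 * n) [::].
Proof. by rewrite -(@card_tilings_region (6 * n) [::] 0). Qed.

End Board.

(** * The transfer operator and its linear recurrence *)

Local Open Scope ring_scope.

(* A formal Z-linear combination of states. *)
Definition config : Type := seq (seq nat * Z).

Fixpoint insert (w : seq nat) (c : Z) (v : config) : config :=
  if v is x :: v' then
    if w == x.1 then (w, c + x.2) :: v' else x :: insert w c v'
  else [:: (w, c)].

Definition evolve (y : nat) (v : config) : config :=
  foldr (fun x acc => foldr (insert^~ x.2) acc (successors y x.1)) [::] v.

Definition block (v : config) : config :=
  iter 4 (fun u => foldl (fun u' y => evolve y u') u (iota 0 6)) v.

(** Horner's scheme for a polynomial in [block] applied to the empty state, highest power first; on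
    [coefsB] this evaluates the reversal of [polyB]. *)
Definition horner_config (s : seq Z) : config :=
  foldl (fun v b => insert [::] b (block v)) [::] s.

Definition value (r : nat) (v : config) : Z :=
  \sum_(x <- v) x.2 * (completions r x.1)%:R.

Lemma value_insert (r : nat) (w : seq nat) (c : Z) (v : config) :
  value r (insert w c v) = c * (completions r w)%:R + value r v.
Proof.
rewrite /value; elim: v => [|[w' c'] v IH] /=; first by rewrite big_seq1 big_nil addr0.
case: eqP => [<-|_]; rewrite !big_cons /=; first by rewrite mulrDl addrA.
by rewrite IH addrCA.
Qed.

Lemma value_evolve (r : nat) (v : config) :
  value r (evolve (5 - r %% 6)%N v) = value r.+1 v.
Proof.
elim: v => [|x v IH]; first by rewrite /value !big_nil.
rewrite {2}/value big_cons -/(value r.+1 v) -IH /= natr_sum mulr_sumr.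
elim: (successors _ _) => [|w s IHs] /=; first by rewrite big_nil add0r.
by rewrite value_insert IHs big_cons addrA.
Qed.

Lemma value_block (n : nat) (v : config) : value (24 * n) (block v) = value (24 * n.+1) v.
Proof.
have column m u : value (6 * m) (foldl (fun u' y => evolve y u') u (iota 0 6))
    = value (6 * m.+1) u.
  (* After the cell in row [y], [i = 5 - y] cells of its column remain. *)
  have step i y u' : (i + y = 5)%N ->
      value (6 * m + i) (evolve y u') = value (6 * m + i.+1) u'.
    by move=> iy; rewrite addnS -value_evolve; congr (value _ (evolve _ _)); lia.
  rewrite -[(6 * m)%N]addn0 /= (step 0 5)%N // (step 1 4)%N // (step 2 3)%N //.
  by rewrite (step 3 2)%N // (step 4 1)%N // (step 5 0)%N //; congr value; lia.
have -> : (24 * n = 6 * (4 * n))%N by lia.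
by rewrite /block /iter !column; congr value; lia.
Qed.

Lemma value_horner_config (s : seq Z) (n : nat) :
  value (24 * n) (horner_config s) =
  \sum_(j < size s) s`_j * (completions (24 * (n + (size s).-1 - j)) [::])%:R.
Proof.
elim/last_ind: s n => [|s b IH] n; first by rewrite /value big_nil big_ord0.
rewrite /horner_config foldl_rcons value_insert value_block IH size_rcons.
rewrite big_ord_recr /= nth_rcons ltnn eqxx addnK addrC; congr (_ + _).
apply: eq_bigr => j _; rewrite nth_rcons ltn_ord.
by have := ltn_ord j => js; congr (_ * (completions (_ * _) _)%:R); lia.
Qed.

(* Coefficients of [- polyA] and [polyB], the constant one first. *)
Definition coefsA (R : pzRingType) : seq R :=
  [:: 1; - 20; 160; - 676; 1679; - 2590; 2546; - 1600; 631; - 149; 19; - 1].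

Definition coefsB (R : pzRingType) : seq R :=
  [:: 1; - 25; 251; - 1330; 4138; - 8001; 9918; - 7944; 4051; - 1280; 239; - 24; 1].

(** Transports the identities computed in [Z] to [rat]. *)
Lemma map_coefsA (R S : pzRingType) (f : {rmorphism R -> S}) :
  [seq f c | c <- coefsA R] = coefsA S.
Proof.
by rewrite /=; do ![apply: (f_equal2 cons);
  first by rewrite ?rmorphN ?rmorph1 ?rmorph_nat].
Qed.

Lemma map_coefsB (R S : pzRingType) (f : {rmorphism R -> S}) :
  [seq f c | c <- coefsB R] = coefsB S.
Proof.
by rewrite /=; do ![apply: (f_equal2 cons);
  first by rewrite ?rmorphN ?rmorph1 ?rmorph_nat].
Qed.

(* The appended 0 is needed: the combination of order 12 is a nonzero combination
   of states, each of which has no completion. *)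
Lemma horner_coefsB_null :
  all (fun x => x.2 == 0) (horner_config (rcons (coefsB Z) 0)).
Proof. by vm_compute. Qed.

(** These are the coefficients 0 to 12 of the product of the series with [polyB]; the final 0
    reflects that [polyA] has degree 11. *)
Lemma value_horner_coefsB :
  [seq value 0 (horner_config (take n.+1 (rcons (coefsB Z) 0))) | n <- iota 0 13]
  = rcons (coefsA Z) 0.
Proof. by rewrite /value unlock; vm_compute. Qed.

Lemma conv_completions (N : nat) :
  \sum_(i < N.+1) (completions (24 * i) [::])%:R * (coefsB Z)`_(N - i) = (coefsA Z)`_N.
Proof.
set s := rcons (coefsB Z) 0.
have es j : (coefsB Z)`_j = s`_j by rewrite nth_rcons_default.
rewrite (reindex_inj rev_ord_inj) /=.
under eq_bigr => j _ do rewrite subSS (subKn (ltn_ord j : j <= N)%N) mulrC es.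
have [N13|N13] := ltnP N 13.
  have := congr1 (fun u => u`_N) value_horner_coefsB.
  rewrite (nth_map 0%N) ?size_iota // nth_iota // add0n nth_rcons_default => <-.
  have := value_horner_config (take N.+1 s) 0; rewrite muln0 => ->.
  have sz : size (take N.+1 s) = N.+1 by rewrite size_takel ?(leqW N13).
  by rewrite sz; apply: eq_bigr => j _; rewrite nth_take.
rewrite [RHS]nth_default //; last exact: leq_trans N13.
(* The 14 entries of [s] give the null combination, [N - 13] blocks later; further entries are the
   default 0. *)
have eN : (N.+1 = 14 + (N - 13))%N by lia.
have := value_horner_config s (N - 13).
rewrite /value big1_seq => [|x /andP[_ xs]]; last first.
  by have /eqP-> := allP horner_coefsB_null x xs; rewrite mul0r.
move=> e; rewrite [RHS]e eN (@big_split_ord _ _ _ 14) /=.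
rewrite [X in _ + X]big1 ?addr0 => [|j _]; last first.
  by rewrite nth_default ?mul0r // leq_addr.
apply: eq_bigr => j _; congr (_ * (completions (_ * _) _)%:R).
by have := ltn_ord j; lia.
Qed.

(** * Algebra of formal power series and the closed form *)

(** Coefficient [n] involves only indices up to [n], so ring laws can be borrowed from truncated
    polynomials. *)
Lemma fps_mulE (N n : nat) (f g : fps) : (n < N)%N ->
  fps_mul f g n = ((\poly_(i < N) f i) * (\poly_(i < N) g i))`_n.
Proof.
move=> nN; rewrite coefM; apply: eq_bigr => i _; rewrite !coef_poly.
by rewrite !(leq_ltn_trans _ nN) ?leq_subr // -ltnS.
Qed.

Lemma fps_mulC (f g : fps) : fps_mul f g =1 fps_mul g f.
Proof. by move=> n; rewrite !(@fps_mulE n.+1) // mulrC. Qed.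

Lemma fps_mulA (f g h : fps) : fps_mul f (fps_mul g h) =1 fps_mul (fps_mul f g) h.
Proof.
move=> n; pose t (u : fps) := \poly_(i < n.+1) u i.
have tE (u : fps) i : (i < n.+1)%N -> u i = (t u)`_i by rewrite coef_poly => ->.
have -> : fps_mul f (fps_mul g h) n = (t f * (t g * t h))`_n.
  rewrite coefM; apply: eq_bigr => i _.
  by rewrite -tE // (@fps_mulE n.+1) // ltnS leq_subr.
have -> : fps_mul (fps_mul f g) h n = ((t f * t g) * t h)`_n.
  rewrite coefM; apply: eq_bigr => i _.
  by rewrite (@fps_mulE n.+1) // -tE // ltnS leq_subr.
by rewrite mulrA.
Qed.

Lemma fps_mulr1 (f : fps) : fps_mul f fps_one =1 f.
Proof.
move=> n; rewrite /fps_mul big_ord_recr /= subnn mulr1 big1 ?add0r // => i _.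
by rewrite /fps_one subn_eq0 leqNgt ltn_ord mulr0.
Qed.

Lemma eq_fps_mul (f f' g g' : fps) : f =1 f' -> g =1 g' -> fps_mul f g =1 fps_mul f' g'.
Proof. by move=> ef eg n; apply: eq_bigr => i _; rewrite ef eg. Qed.

Lemma fps_divP (f g h : fps) : g 0%N != 0 -> fps_mul h g =1 f -> h =1 fps_div f g.
Proof.
move=> g0 hg n; have ginv : fps_one =1 fps_mul g (fps_inv g).
  by move=> m; rewrite fps_mulC fps_mulVf.
rewrite -[LHS]fps_mulr1 (eq_fps_mul _ _ _ _ (frefl h) ginv) fps_mulA.
exact: eq_fps_mul.
Qed.

(* Variable coefficients: unifying distinct numerals of [rat] would unfold them
   into unary computations. *)
Lemma Poly_deg12 (R : comNzRingType) (c1 c2 c3 c4 c5 c6 c7 c8 c9 c10 c11 : R) :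
  'X^12 - c11 *: 'X^11 + c10 *: 'X^10 - c9 *: 'X^9 + c8 *: 'X^8 - c7 *: 'X^7
  + c6 *: 'X^6 - c5 *: 'X^5 + c4 *: 'X^4 - c3 *: 'X^3 + c2 *: 'X^2 - c1 *: 'X + 1
  = Poly [:: 1; - c1; c2; - c3; c4; - c5; c6; - c7; c8; - c9; c10; - c11; 1].
Proof.
rewrite /= !cons_poly_def !polyCN polyC1 -!mul_polyC; ring.
Qed.

Lemma polyBE : polyB = Poly (coefsB rat).
Proof.
rewrite /polyB /coefsB.
refine (Poly_deg12 _ 25 251 1330 4138 8001 9918 7944 4051 1280 239 24).
Qed.

(** The entries are convolutions with 1, -2, 1, up to the alternating signs. *)
Lemma Poly_sqr_deg9 (R : comNzRingType) (c1 c2 c3 c4 c5 c6 c7 c8 : R) :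
  - (('X - 1) ^+ 2 * ('X^9 - c8 *: 'X^8 + c7 *: 'X^7 - c6 *: 'X^6 + c5 *: 'X^5
    - c4 *: 'X^4 + c3 *: 'X^3 - c2 *: 'X^2 + c1 *: 'X - 1))
  = Poly [:: 1; - (c1 + 2); c2 + c1 *+ 2 + 1;
             - (c3 + c2 *+ 2 + c1); c4 + c3 *+ 2 + c2; - (c5 + c4 *+ 2 + c3);
             c6 + c5 *+ 2 + c4; - (c7 + c6 *+ 2 + c5); c8 + c7 *+ 2 + c6;
             - (1 + c8 *+ 2 + c7); c8 + 2; - 1].
Proof.
rewrite /= !cons_poly_def !(polyCN, polyCD, polyCMn) polyC1 -!mul_polyC; ring.
Qed.

Lemma oppr_polyAE : - polyA = Poly (coefsA rat).
Proof.
refine (etrans (Poly_sqr_deg9 _ 18 123 412 732 714 386 114 17) _).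
by apply: (congr1 (@Poly rat)); apply/eqP; vm_compute.
Qed.

(* The initial values are compared in binary, [bin_of_nat : nat -> N] being
   injective, so that the large literals are not unary numbers. *)
Theorem proposition7 :
  let a : nat -> nat := fun n : nat => num_tilings 6 (4 * n) in
  gen_fun a =1 fps_div (fps_of_poly (- polyA)) (fps_of_poly polyB)
  /\ [seq bin_of_nat (a n) | n <- iota 0 9]
     = [:: 1; 5; 34; 249; 1882; 14492; 113029; 889719; 7050677]%num.
Proof.
move=> a; have aE n : a n = completions (24 * n) [::].
  by rewrite /a num_tilings6 mulnA.
pose phi : {rmorphism Z -> rat} := intr \o int_of_Z.
have phi_nth (s : forall R : pzRingType, seq R) n :
    [seq phi c | c <- s Z] = s rat -> (s rat)`_n = phi (s Z)`_n.
  move=> <-; have [sn|sn] := ltnP n (size (s Z)); first exact: nth_map.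
  by rewrite !nth_default ?size_map ?rmorph0.
split.
  apply: fps_divP => [|N]; first by rewrite polyB_coef0 oner_eq0.
  rewrite /fps_of_poly oppr_polyAE polyBE coef_Poly (phi_nth coefsA) ?map_coefsA //.
  rewrite -conv_completions rmorph_sum; apply: eq_bigr => i _.
  by rewrite rmorphM rmorph_nat -aE coef_Poly (phi_nth coefsB) ?map_coefsB.
(* Iterating [block] merges equal states, avoiding the exponential branching of [completions]. *)
have aZ n : (a n)%:R = value 0 (iter n block [:: ([::], 1)]).
  transitivity (value (24 * n) [:: ([::], 1)]); first by rewrite /value big_seq1 mul1r aE.
  by elim: n [:: _] => //= n IH v; rewrite -value_block IH -iterSr.
have binE n : bin_of_nat (a n) = Z.to_N (value 0 (iter n block [:: ([::], 1)])).
  by rewrite -aZ; lia.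
by rewrite (eq_map binE) /value unlock; vm_compute.
Qed.
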